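(* Let $F$ be a field of characteristic zero. For every $t\in F$ and every integer $n>0$, the linear map $\mathsf{t}_n:\operatorname{End}_{\underline{\operatorname{Rep}}(S_t)}(M_n)\to F$ determined by $\mathsf{t}_n(s_n)=1$ and $\mathsf{t}_n(s_nx_ns_n)=1$ is a nonzero ambidextrous trace on the object $M_n=([n],s_n)$ of Deligne's category $\underline{\operatorname{Rep}}(S_t)$. That is, $\mathsf{t}_n\neq 0$ and $\mathsf{t}_n(\operatorname{tr}_L(h))=\mathsf{t}_n(\operatorname{tr}_R(h))$ for all $h\in\operatorname{End}_{\underline{\operatorname{Rep}}(S_t)}(M_n\otimes M_n)$.
   Context: Partition diagrams. For $a,b\ge 0$, $P_{a,b}$ is the set of set partitions (partition diagrams) of $\{1,\dots,a,1',\dots,b'\}$ (unprimed = top vertices, primed = bottom vertices), and $FP_{a,b}=FP_{a,b}(t)$ is the $F$-vector space with basis $P_{a,b}$. For $\pi\in P_{a,b}$, $\mu\in P_{b,c}$, the composite $\mu\pi\in FP_{a,c}$ is obtained by stacking $\pi$ on top of $\mu$, identifying bottom vertices of $\pi$ with top vertices of $\mu$, taking the induced partition on the outer vertices, and multiplying by $t^{\ell}$, where $\ell$ is the number of connected components consisting only of middle vertices. Write $P_n=P_{n,n}$ and $FP_n=FP_n(t)=FP_{n,n}(t)$ (the partition algebra). A permutation $\sigma\in S_n$ is identified with the diagram with parts $\{i,\sigma(i)'\}$, so $FS_n\subset FP_n$. Deligne's category. $\underline{\operatorname{Rep}}_0(S_t)$ has objects $[n]$, $n\in\mathbb{Z}_{\ge0}$,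 and $\operatorname{Hom}([a],[b])=FP_{a,b}(t)$, with the composite of $\pi:[a]\to[b]$ and $\mu:[b]\to[c]$ given by the bilinear extension of the stacking product $(\mu,\pi)\mapsto\mu\pi\in FP_{a,c}(t)$ of partition diagrams ($\pi$ stacked on top of $\mu$, with a factor $t$ for each connected component consisting only of middle vertices); $[a]\otimes[b]=[a+b]$, with horizontal juxtaposition of diagrams as tensor product of morphisms; unit $[0]$; symmetric braiding by the obvious block permutation diagrams; $[n]^*=[n]$ with evaluation the diagram with parts $\{i,n+i\}$ and coevaluation the diagram with parts $\{i',(n+i)'\}$; trivial twists. $\underline{\operatorname{Rep}}(S_t)$ is the Karoubian envelope of the additive envelope of $\underline{\operatorname{Rep}}_0(S_t)$. For an idempotent $e\in FP_n(t)$, $([n],e)$ is the corresponding object, with $\operatorname{End}(([n],e))=eFP_n(t)e$, and $([n],e)\otimes([m],f)=([n+m],e\otimes f)$. Particular elements. $s_n=\frac1{n!}\sum_{\sigma\in S_n}\operatorname{sgn}(\sigma)\sigma$; $M_n=([n],s_n)$; $x_n\in P_n$ is the diagram with parts $\{i,i'\}$ for $1\le i\le n-1$, together with the singletons $\{n\}$ and $\{n'\}$. For $n>0$ the set $\{s_n,s_nx_ns_n\}$ is a basis of $\operatorname{End}(M_n)=s_nFP_n(t)s_n$, so $\mathsf{t}_n$ is well defined. Partial traces. In a ribbon category, for $f\in\operatorname{End}(V\otimes W)$, $\operatorname{tr}_L(f)=(\operatorname{ev}_V\otimes \operatorname{Id}_W)(\operatorname{Id}_{V^*}\otimes f)(\operatorname{coev}'_V\otimes\operatorname{Id}_W)\in\operatorname{End}(W)$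 and $\operatorname{tr}_R(f)=(\operatorname{Id}_V\otimes\operatorname{ev}'_W)(f\otimes\operatorname{Id}_{W^*})(\operatorname{Id}_V\otimes\operatorname{coev}_W)\in\operatorname{End}(V)$, where $\operatorname{coev}'_V=(\operatorname{Id}_{V^*}\otimes\theta_V)c_{V,V^*}\operatorname{coev}_V$ and $\operatorname{ev}'_V=\operatorname{ev}_Vc_{V,V^*}(\theta_V\otimes\operatorname{Id}_{V^*})$, with $c$ the braiding and $\theta$ the twist. Concretely, for $h\in\operatorname{End}(M_n\otimes M_n)=(s_n\otimes s_n)FP_{2n}(t)(s_n\otimes s_n)$, these are given by linear extension from diagrams $\pi\in P_{2n}$: $\operatorname{tr}_R(\pi)\in FP_n$ is obtained by joining $n+i$ with $(n+i)'$ for $1\le i\le n$, restricting the resulting partition to $\{1,\dots,n,1',\dots,n'\}$, and multiplying by $t^{\ell}$, where $\ell$ is the number of components containing only vertices $n+i,(n+i)'$; $\operatorname{tr}_L(\pi)$ is obtained likewise by joining $i$ with $i'$ for $1\le i\le n$, restricting to the remaining vertices (relabelled by subtracting $n$), and multiplying by $t$ to the number of components containing only vertices $i,i'$ with $1\le i\le n$. An ambidextrous trace on an object $J$ is a linear map $\mathsf{t}_J:\operatorname{End}(J)\to F$ with $\mathsf{t}_J(\operatorname{tr}_L(h))=\mathsf{t}_J(\operatorname{tr}_R(h))$ for all $h\in\operatorname{End}(J\otimes J)$. *)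

(* Defs.v *)
From HB Require Import structures.
From mathcomp Require Import all_boot all_order all_algebra all_fingroup.

Set Implicit Arguments.
Unset Strict Implicit.
Unset Printing Implicit Defensive.

Import GRing.Theory.
Local Open Scope ring_scope.

(* A diagram from a to b: 'inl i' is the top vertex i and 'inr j' the bottom
   vertex j', both numbered from 0. *)
Definition pdiag (a b : nat) : Type :=
  {P : {set {set 'I_a + 'I_b}} | partition P [set: 'I_a + 'I_b]}.

Section Glue.
Variables (T : finType) (r : rel T).

Definition eqv : rel T := connect (fun x y => r x y || r y x).

Lemma eqv_equiv : equivalence_rel eqv.
Proof.
have eqvC : connect_sym (fun x y => r x y || r y x).
  by apply: sym_connect_sym => x y; rewrite orbC.
move=> x y z; split; first exact: connect0.
by move=> xy; apply: same_connect.
Qed.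

Section Restrict.
Variables (U : finType) (i : U -> T).

Definition induced : {set {set U}} :=
  equivalence_partition (fun u v => eqv (i u) (i v)) [set: U].

Lemma induced_partition : partition induced [set: U].
Proof. by apply: equivalence_partitionP => u v w _ _ _; apply: eqv_equiv. Qed.

Definition nloops : nat :=
  #|[set C in equivalence_partition eqv [set: T] | [disjoint C & codom i]]|.

End Restrict.
End Glue.

(* The partition of the outer vertices, embedded by i in a larger vertex set T,
   into the traces of the connected components of the graph (T, r). *)
Definition diag_of (a b : nat) (T : finType) (i : 'I_a + 'I_b -> T)
  (r : rel T) : pdiag a b := exist _ (induced r i) (induced_partition r i).

Definition push (U T : finType) (f : U -> T) (P : {set {set U}}) : rel T :=
  fun x y => [exists B in P, (x \in f @: B) && (y \in f @: B)].

Definition stack_vertex (a b c : nat) : finType := ('I_a + 'I_b + 'I_c)%type.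

Definition stack_upper a b c (x : 'I_a + 'I_b) : stack_vertex a b c := inl x.

Definition stack_lower a b c (x : 'I_b + 'I_c) : stack_vertex a b c :=
  match x with inl j => inl (inr j) | inr k => inr k end.

Definition stack_outer a b c (x : 'I_a + 'I_c) : stack_vertex a b c :=
  match x with inl i => inl (inl i) | inr k => inr k end.

Definition stack_rel a b c (m : pdiag b c) (p : pdiag a b) :
    rel (stack_vertex a b c) :=
  fun x y => push (@stack_upper a b c) (val p) x y
          || push (@stack_lower a b c) (val m) x y.

Definition juxt_left a b c d (x : 'I_a + 'I_b) : 'I_(a + c) + 'I_(b + d) :=
  match x with inl i => inl (lshift c i) | inr j => inr (lshift d j) end.

Definition juxt_right a b c d (x : 'I_c + 'I_d) : 'I_(a + c) + 'I_(b + d) :=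
  match x with inl i => inl (rshift a i) | inr j => inr (rshift b j) end.

Definition juxt a b c d (p : pdiag a b) (q : pdiag c d) :
    pdiag (a + c) (b + d) :=
  diag_of id (fun x y => push (@juxt_left a b c d) (val p) x y
                      || push (@juxt_right a b c d) (val q) x y).

Definition perm_diag n (s : 'S_n) : pdiag n n :=
  diag_of id (fun x y => [exists i, (x == inl i) && (y == inr (s i))]).

Definition x_diag n : pdiag n n :=
  diag_of id (fun x y =>
    [exists i : 'I_n, [&& (i.+1 < n)%N, x == inl i & y == inr i]]).

Definition join_left_rel m n (p : pdiag (m + n) (m + n)) :
    rel ('I_(m + n) + 'I_(m + n))%type :=
  fun x y => push id (val p) x y
    || [exists i : 'I_m, (x == inl (lshift n i)) && (y == inr (lshift n i))].

Definition join_right_rel m n (p : pdiag (m + n) (m + n)) :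
    rel ('I_(m + n) + 'I_(m + n))%type :=
  fun x y => push id (val p) x y
    || [exists i : 'I_n, (x == inl (rshift m i)) && (y == inr (rshift m i))].

Section PartitionAlgebra.
Variables (F : fieldType) (t : F).

Definition FP (a b : nat) : vectType F := {ffun pdiag a b -> F^o}.

Definition basis a b (p : pdiag a b) : FP a b := [ffun q => (q == p)%:R].

Definition comp_diag a b c (m : pdiag b c) (p : pdiag a b) : FP a c :=
  t ^+ nloops (stack_rel m p) (@stack_outer a b c)
    *: basis (diag_of (@stack_outer a b c) (stack_rel m p)).

Definition comp a b c (g : FP b c) (f : FP a b) : FP a c :=
  \sum_m \sum_p (g m * f p) *: comp_diag m p.

Definition tens a b c d (f : FP a b) (g : FP c d) : FP (a + c) (b + d) :=
  \sum_p \sum_q (f p * g q) *: basis (juxt p q).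

Definition trL_diag m n (p : pdiag (m + n) (m + n)) : FP n n :=
  t ^+ nloops (join_left_rel p) (@juxt_right m m n n)
    *: basis (diag_of (@juxt_right m m n n) (join_left_rel p)).

Definition trR_diag m n (p : pdiag (m + n) (m + n)) : FP m m :=
  t ^+ nloops (join_right_rel p) (@juxt_left m m n n)
    *: basis (diag_of (@juxt_left m m n n) (join_right_rel p)).

Definition trL m n (h : FP (m + n) (m + n)) : FP n n :=
  \sum_p h p *: trL_diag p.

Definition trR m n (h : FP (m + n) (m + n)) : FP m m :=
  \sum_p h p *: trR_diag p.

Definition sandwich n (e f : FP n n) : FP n n := comp e (comp f e).

Lemma comp_linear_l a b c (f : FP a b) : linear (fun g : FP b c => comp g f).
Proof.
move=> k g g'; rewrite /comp scaler_sumr -big_split /=; apply: eq_bigr => m _.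
rewrite scaler_sumr -big_split /=; apply: eq_bigr => p _.
by rewrite !ffunE mulrDl scalerDl -[k *: g m]/(k * g m) -(mulrA k) -(scalerA k).
Qed.

Lemma comp_linear_r a b c (g : FP b c) : linear (fun f : FP a b => comp g f).
Proof.
move=> k f f'; rewrite /comp scaler_sumr -big_split /=; apply: eq_bigr => m _.
rewrite scaler_sumr -big_split /=; apply: eq_bigr => p _.
by rewrite !ffunE mulrDr scalerDl -[k *: f p]/(k * f p) mulrCA -(scalerA k).
Qed.

Fact sandwich_linear n (e : FP n n) : linear (sandwich e).
Proof. by move=> k f f'; rewrite /sandwich comp_linear_l comp_linear_r. Qed.

HB.instance Definition _ n (e : FP n n) :=
  GRing.isLinear.Build F (FP n n) (FP n n) _ (sandwich e) (sandwich_linear e).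

(* End(([n], e)) = e FP_n e, for an idempotent e. *)
Definition EndK n (e : FP n n) : {vspace FP n n} := limg (linfun (sandwich e)).

(* For idempotent e, trL h and trR h lie in EndK e; vsproj, which is the
   identity on EndK e, only serves to give them the type subvs_of (EndK e). *)
Definition ambidextrous n (e : FP n n)
    (T : 'Hom(subvs_of (EndK e), F^o)) : Prop :=
  forall h : FP (n + n) (n + n), h \in EndK (tens e e) ->
    T (vsproj (EndK e) (trL h)) = T (vsproj (EndK e) (trR h)).

End PartitionAlgebra.

Section Antisymmetrizer.
Variables (F : fieldType) (t : F) (n : nat).

Definition antisym : FP F n n :=
  (n`!%:R)^-1 *: \sum_(s : 'S_n) (-1) ^+ s *: basis F (perm_diag s).

(* Here too vsproj is a mere retyping: s_n and s_n x_n s_n lie in End(M_n). *)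
Definition is_tn (T : 'Hom(subvs_of (EndK t antisym), F^o)) : Prop :=
  T (vsproj (EndK t antisym) antisym) = 1
  /\ T (vsproj (EndK t antisym) (sandwich t antisym (basis F (x_diag n)))) = 1.

End Antisymmetrizer.

(* Main.v *)
From HB Require Import structures.
Require Import Defs.
From mathcomp Require Import all_boot all_order all_algebra all_fingroup.

(** Why the trace exists.  Sandwiching a diagram p between antisymmetrizers gives
    a multiple of the signed sum [alt p] of its relabellings by pairs of
    permutations.  This vanishes as soon as some transposition of two top, or of
    two bottom, vertices fixes p, which happens when two of them share a block
    or are both singletons.  The surviving diagrams are, up to relabelling, the
    identity and x_n, so End(M_n) is spanned by s_n and s_n x_n s_n
    ([alt_cases], [EndK_span]); this gives uniqueness.  For existence, let
    [chi d] be the ordinary trace with d + 1 colors: a diagram is sent to the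
    number of colorings of its vertices that are constant on blocks and give i
    and i' the same color.  In the signed sum the colorings in which two top
    vertices share a color cancel out, and for the others only pairs of equal
    permutations contribute, for the identity and for x_n alike ([chi_alt]).
    So every [chi d] takes equal values on s_n and s_n x_n s_n, and, with at
    least n colors, a scalar multiple of it is t_n: the ordinary traces for all
    numbers of colors are proportional on End(M_n) ([chi_EndK]).

    Why it is ambidextrous.  When t is the number d + 1 of colors, taking a
    partial trace and then [chi d] amounts to [chi d] of the whole endomorphism,
    whichever side is closed first: a middle component without outer vertices
    contributes one factor t, that is, one free choice of a color
    ([card_extensions], [chi_trace]).  Hence [chi d] has equal values on tr_L h
    and tr_R h, and by proportionality so has t_n, which is a multiple of
    [chi (n - 1)].  Now h itself can be kept fixed while the parameter of the
    partial traces varies, since composing with permutations closes no loop and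
    an element of End(M_n (x) M_n) is therefore a combination of alternating
    sums in which t does not occur.  The difference of the values of t_n on the
    two partial traces is then a polynomial in the parameter that vanishes at
    all large integers, so it is zero and may be evaluated at the given t
    ([chi_trL_trR]).  The partial traces do belong to End(M_n), because closing
    up one tensor factor commutes with relabelling the other
    ([trace_alt], [trL_EndK], [trR_EndK]). *)

Import GRing.Theory.
Local Open Scope ring_scope.

Set Implicit Arguments.
Unset Strict Implicit.
Unset Printing Implicit Defensive.

(** * Connected components and colorings *)

Definition coloring (S T : finType) (r : rel T) (C : {ffun T -> S}) : bool :=
  [forall x, forall y, r x y ==> (C x == C y)].

Lemma coloringP (S T : finType) (r : rel T) (C : {ffun T -> S}) :
  reflect (forall x y, r x y -> C x = C y) (coloring r C).
Proof.
apply: (iffP forallP) => [H x y rxy|H x].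
  by move/forallP: (H x) => /(_ y)/implyP/(_ rxy)/eqP.
by apply/forallP => y; apply/implyP => /H ->.
Qed.

Section Connectivity.
Variables (T : finType) (r : rel T).

Lemma eqv_refl x : eqv r x x.
Proof. exact: connect0. Qed.

Lemma eqv_trans x y z : eqv r x y -> eqv r y z -> eqv r x z.
Proof. exact: connect_trans. Qed.

Lemma eqv_sym x y : eqv r x y = eqv r y x.
Proof. by apply: sym_connect_sym => a b; rewrite orbC. Qed.

Lemma eqv_edge x y : r x y -> eqv r x y.
Proof. by move=> rxy; apply: connect1; rewrite rxy. Qed.

(** With [eqv_edge], the universal property through which all connectivity
    questions below are settled: no path is ever exhibited. *)
Lemma eqv_invariant (S : Type) (f : T -> S) :
  (forall x y, r x y -> f x = f y) -> forall x y, eqv r x y -> f x = f y.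
Proof.
move=> rf x y /connectP[s rs ->] {y}.
elim: s x rs => //= y s IH x /andP[/orP[/rf->|/rf<-] /IH] //.
Qed.

Lemma eqvE (S : eqType) (f : T -> S) :
    (forall x y, r x y -> f x = f y) ->
    (forall x y, f x = f y -> eqv r x y) ->
  forall x y, eqv r x y = (f x == f y).
Proof.
move=> rf fr x y; apply/idP/eqP => [|/fr //]; exact: eqv_invariant.
Qed.

Definition component (x : T) : {set T} := [set y | eqv r x y].

Lemma component_eq x y : (component x == component y) = eqv r x y.
Proof.
apply/eqP/idP => [/setP/(_ y)|xy]; first by rewrite !inE eqv_refl.
apply/setP => z; rewrite !inE; apply/idP/idP; last exact: eqv_trans.
by apply: eqv_trans; rewrite eqv_sym.
Qed.

Section Restrict.
Variables (U : finType) (i : U -> T).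

(** The components counted by [nloops], as the image of the vertices from which
    the outer vertices cannot be reached. *)
Definition loops : {set {set T}} :=
  [set component x | x in [set x | [forall u, ~~ eqv r x (i u)]]].

Lemma component_loop x :
  (component x \in loops) = [forall u, ~~ eqv r x (i u)].
Proof.
apply/imsetP/idP => [[y]|xP]; last by exists x; rewrite ?inE.
rewrite inE => /forallP yP /eqP; rewrite component_eq => xy.
apply/forallP => u; apply: contra (yP u); apply: eqv_trans.
by rewrite eqv_sym.
Qed.

Lemma nloopsE : nloops r i = #|loops|.
Proof.
congr #|pred_of_set _|; apply/setP => C; rewrite inE /equivalence_partition.
have imE x : [set y in [set: T] | eqv r x y] = component x.
  by apply/setP => y; rewrite !inE.
apply/andP/imsetP => [[/imsetP[x _ ->]]|[x xP ->]].
  rewrite imE => dis.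
  exists x; rewrite // inE; apply/forallP => u; apply/negP => xu.
  move/pred0P: dis => /(_ (i u)) /=.
  by rewrite codom_f andbT inE xu.
split; first by rewrite -imE imset_f ?inE.
apply/pred0P => y /=; apply/negP => /andP[xy /codomP[u yu]].
by move: xP xy; rewrite !inE yu => /forallP/(_ u)/negP.
Qed.

Lemma nloops0 : (forall x, exists u, eqv r x (i u)) -> nloops r i = 0%N.
Proof.
move=> H; rewrite nloopsE; apply/eqP; rewrite cards_eq0.
apply/eqP/setP => C; rewrite !inE; apply/imsetP => -[x].
by rewrite inE => /forallP xP _; have [u xu] := H x; move: (xP u); rewrite xu.
Qed.

(** The color of a component that meets the outer vertices is forced by c, and
    each of the other components receives an arbitrary color.  This is what the
    factor t per closed component stands for when t is a number of colors. *)
Lemma card_extensions d (c : {ffun U -> 'I_d.+1}) :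
    (forall u v, eqv r (i u) (i v) -> c u = c v) ->
  #|[set C : {ffun T -> 'I_d.+1} | coloring r C && [forall u, C (i u) == c u]]|
    = (d.+1 ^ nloops r i)%N.
Proof.
move=> cP; pose L := {A : {set T} | A \in loops}.
pose base x := if [pick u | eqv r x (i u)] is Some u then c u else ord0.
pose Psi (g : {ffun L -> 'I_d.+1}) : {ffun T -> 'I_d.+1} :=
  [ffun x => if insub (component x) is Some l then g l else base x].
have baseE x u : eqv r x (i u) -> base x = c u.
  rewrite /base => xu; case: pickP => [v xv|/(_ u)]; last by rewrite xu.
  by apply: cP; apply: eqv_trans xu; rewrite eqv_sym.
have outE x u : eqv r x (i u) -> insub (component x) = None :> option L.
  move=> xu; apply: insubN; rewrite component_loop negb_forall.
  by apply/existsP; exists u; rewrite negbK.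
transitivity #|[set Psi g | g in {: {ffun L -> 'I_d.+1}}]|; last first.
  (* [Psi] is injective: each loop has a vertex, where the color of that loop
     can be read off. *)
  rewrite card_imset ?card_ffun ?card_ord ?card_sig ?nloopsE //.
  move=> g g' /ffunP gg'; apply/ffunP => l.
  have [x _ lx] := imsetP (valP l).
  by move: (gg' x); rewrite !ffunE -lx valK.
congr #|pred_of_set _|; apply/setP => C; rewrite inE.
apply/andP/imsetP => [[/coloringP rC /forallP Ci]|[g _ ->]].
  exists [ffun l : L => if [pick x in val l] is Some x then C x else ord0];
    first by [].
  apply/ffunP => x; rewrite ffunE; case: insubP => [l _ lx|].
    rewrite ffunE lx; case: pickP => [y|/(_ x)]; rewrite inE ?eqv_refl //.
    exact: eqv_invariant.
  rewrite component_loop negb_forall => /existsP[u]; rewrite negbK => xu.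
  by rewrite (baseE _ _ xu) -(eqP (Ci u)); apply: eqv_invariant xu.
split; last first.
  apply/forallP => u; rewrite ffunE (outE _ u) ?eqv_refl //.
  by rewrite (baseE _ u) ?eqv_refl.
apply/coloringP => x y /eqv_edge xy; rewrite !ffunE.
have := xy; rewrite -component_eq => /eqP <-.
case: insubP => // ; rewrite component_loop negb_forall => /existsP[u].
rewrite negbK => xu; rewrite (baseE _ _ xu); apply/esym/baseE.
by apply: eqv_trans xu; rewrite eqv_sym.
Qed.

End Restrict.
End Connectivity.

(** * Blocks of a diagram and relabelling of its vertices *)

Section Blocks.
Variables (a b : nat).
Implicit Types (p q : pdiag a b) (u v w : 'I_a + 'I_b).

Definition same p : rel ('I_a + 'I_b) :=
  fun u v => pblock (val p) u == pblock (val p) v.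

Lemma same_pblock p u v : same p u v = (v \in pblock (val p) u).
Proof.
have /and3P[/eqP covp tp _] := valP p.
by rewrite /same eq_pblock // covp inE.
Qed.

(** Diagrams are compared through the relation [same], not as sets of sets. *)
Lemma diag_eq p q : same p =2 same q -> p = q.
Proof.
move=> pq; apply: val_inj.
rewrite -(equivalence_partition_pblock (valP p)).
rewrite -(equivalence_partition_pblock (valP q)).
apply/setP => B; apply/imsetP/imsetP => -[u _ ->]; exists u => //;
  apply/setP => v; rewrite !inE;
  by rewrite -!same_pblock pq.
Qed.

Lemma same_diag_of (T : finType) (i : 'I_a + 'I_b -> T) (r : rel T) u v :
  same (diag_of i r) u v = eqv r (i u) (i v).
Proof.
rewrite same_pblock /= pblock_equivalence_partition ?inE //.
by move=> x y z _ _ _; apply: eqv_equiv.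
Qed.

Lemma pushP (T : finType) (f : 'I_a + 'I_b -> T) p x y :
  reflect (exists u v, [/\ x = f u, y = f v & same p u v]) (push f (val p) x y).
Proof.
have /and3P[/eqP covp tp _] := valP p.
apply: (iffP existsP) => [[B /and3P[Bp /imsetP[u uB ->] /imsetP[v vB ->]]]|].
  exists u, v; split=> //.
  by rewrite same_pblock (def_pblock tp Bp uB).
move=> [u [v [-> -> uv]]]; exists (pblock (val p) u).
rewrite pblock_mem ?covp ?inE //= !imset_f // -same_pblock ?uv //.
exact: eqxx.
Qed.

Lemma push_id p : push id (val p) =2 same p.
Proof.
move=> u v; apply/pushP/idP => [[u' [v' [-> -> //]]]|uv]; by exists u, v.
Qed.

End Blocks.

Section Pull.

(** Relabelling when g is a bijection; the vertex u of the new diagram plays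
    the role of the vertex g u of p. *)
Definition pull a b c d (g : 'I_c + 'I_d -> 'I_a + 'I_b) (p : pdiag a b) :
  pdiag c d := diag_of g (same p).

Lemma eqv_same a b (p : pdiag a b) : eqv (same p) =2 same p.
Proof.
move=> u v; rewrite (@eqvE _ _ _ (pblock (val p))) // => x y.
  by move/eqP.
by move=> xy; apply: eqv_edge; apply/eqP.
Qed.

Lemma same_pull a b c d (g : 'I_c + 'I_d -> 'I_a + 'I_b) (p : pdiag a b) u v :
  same (pull g p) u v = same p (g u) (g v).
Proof. by rewrite same_diag_of eqv_same. Qed.

End Pull.

Section Perm.
Variable n : nat.
Implicit Types (s t : 'S_n) (p : pdiag n n).

Definition ext s t (x : 'I_n + 'I_n) : 'I_n + 'I_n :=
  match x with inl i => inl (s i) | inr j => inr (t j) end.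

Lemma ext_comp s t s' t' x :
  ext s t (ext s' t' x) = ext (s' * s)%g (t' * t)%g x.
Proof. by case: x => k /=; rewrite permM. Qed.

Lemma ext1 x : ext 1%g 1%g x = x.
Proof. by case: x => k /=; rewrite perm1. Qed.

Lemma extK s t : cancel (ext s t) (ext s^-1%g t^-1%g).
Proof. by move=> x; rewrite ext_comp !mulgV ext1. Qed.

Lemma extVK s t : cancel (ext s^-1%g t^-1%g) (ext s t).
Proof. by move=> x; rewrite ext_comp !mulVg ext1. Qed.

Lemma pull_ext s t s' t' p :
  pull (ext s t) (pull (ext s' t') p) = pull (ext (s * s')%g (t * t')%g) p.
Proof. by apply: diag_eq => u v; rewrite !same_pull !ext_comp. Qed.

(** The top vertex of the block of x in [perm_diag s]. *)
Definition foot s (x : 'I_n + 'I_n) : 'I_n :=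
  match x with inl i => i | inr j => (s^-1)%g j end.

Lemma same_perm s u v : same (perm_diag s) u v = (foot s u == foot s v).
Proof.
rewrite same_diag_of; apply: eqvE => {u v} [x y|u v].
  by move=> /existsP[i /andP[/eqP-> /eqP->]] /=; rewrite permK.
have top w : eqv (fun x y => [exists i, (x == inl i) && (y == inr (s i))])
    w (inl (foot s w)).
  case: w => k; first exact: eqv_refl.
  rewrite eqv_sym; apply: eqv_edge; apply/existsP; exists ((s^-1)%g k).
  by rewrite permKV !eqxx.
by move=> uv; apply: eqv_trans (top u) _; rewrite uv eqv_sym.
Qed.

Lemma perm_diag_pull s t :
  pull (ext s t) (perm_diag 1%g) = perm_diag (s * t^-1)%g.
Proof.
apply: diag_eq => u v; rewrite same_pull !same_perm.
have footE w : foot 1%g (ext s t w) = s (foot (s * t^-1)%g w).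
  by case: w => k //=; rewrite invg1 perm1 invMg invgK permM permKV.
by rewrite !footE (inj_eq perm_inj).
Qed.

(** A representative of the block of x in [x_diag n]: the last bottom vertex is
    the only one not linked to the top. *)
Definition xlabel (x : 'I_n + 'I_n) : 'I_n + 'I_n :=
  match x with
  | inl i => inl i
  | inr j => if (j.+1 < n)%N then inl j else inr j
  end.

Lemma same_x u v : same (x_diag n) u v = (xlabel u == xlabel v).
Proof.
rewrite same_diag_of; set r := (X in eqv X _ _).
apply: eqvE => {u v} [x y|u v].
  by move=> /existsP[i /and3P[lt_i /eqP-> /eqP->]] /=; rewrite lt_i.
have top w : eqv r w (xlabel w).
  case: w => k /=; first exact: eqv_refl.
  case: ifP => lt_k; last exact: eqv_refl.
  rewrite eqv_sym; apply: eqv_edge; apply/existsP; exists k.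
  by rewrite lt_k !eqxx.
by move=> uv; apply: eqv_trans (top u) _; rewrite uv eqv_sym.
Qed.

End Perm.

(** * Composition with permutations *)

(** Components of a graph that contracts onto a diagram p: each vertex x is
    connected to its image f x among the vertices of p, and the edges join only
    vertices whose images share a block. *)
Lemma eqv_retract a b (p : pdiag a b) (T : finType) (r : rel T)
    (e : 'I_a + 'I_b -> T) (f : T -> 'I_a + 'I_b) :
    (forall x y, r x y -> same p (f x) (f y)) ->
    (forall u v, same p u v -> eqv r (e u) (e v)) ->
    (forall x, eqv r x (e (f x))) ->
  forall x y, eqv r x y = same p (f x) (f y).
Proof.
move=> rf er ef x y; rewrite (@eqvE _ _ _ (fun z => pblock (val p) (f z))) //.
  by move=> {x y} x y /rf/eqP.
move=> {x y} x y /eqP xy; apply: eqv_trans (ef x) _; rewrite eqv_sym.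
by apply: eqv_trans (ef y) _; apply: er; rewrite /same eq_sym.
Qed.

Section StackPerm.
Variables (n : nat) (s : 'S_n) (p : pdiag n n).

Let lower_edge i :
  eqv (stack_rel (perm_diag s) p) (inl (inr i)) (inr (s i)).
Proof.
apply: eqv_edge; apply/orP; right; apply/pushP.
by exists (inl i), (inr (s i)); split=> //; rewrite same_perm /= permK.
Qed.

Let upper_edge i :
  eqv (stack_rel p (perm_diag s)) (inl (inl i)) (inl (inr (s i))).
Proof.
apply: eqv_edge; apply/orP; left; apply/pushP.
by exists (inl i), (inr (s i)); split=> //; rewrite same_perm /= permK.
Qed.

(** A permutation diagram only renames the vertices that it is stacked on: the
    stacked graph contracts onto the other factor. *)
Lemma stack_perm_below (x y : stack_vertex n n n) :
  let f (z : stack_vertex n n n) :=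
    match z with inl w => w | inr k => inr ((s^-1)%g k) end in
  eqv (stack_rel (perm_diag s) p) x y = same p (f x) (f y).
Proof.
move=> f; apply: (@eqv_retract _ _ _ _ _ (@stack_upper n n n)) => {x y}.
- move=> x y /orP[] /pushP[u [v [-> -> //]]].
  rewrite same_perm => /eqP uv.
  have fE w : f (stack_lower n w) = inr (foot s w) by case: w.
  by rewrite !fE uv /same.
- by move=> u v uv; apply: eqv_edge; apply/orP; left; apply/pushP; exists u, v.
case=> [w|k] /=; first exact: eqv_refl.
by rewrite eqv_sym; have := lower_edge ((s^-1)%g k); rewrite permKV.
Qed.

Lemma stack_perm_above (x y : stack_vertex n n n) :
  let f (z : stack_vertex n n n) : 'I_n + 'I_n :=
    match z with
    | inl (inl i) => inl (s i) | inl (inr j) => inl j | inr k => inr k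
    end in
  eqv (stack_rel p (perm_diag s)) x y = same p (f x) (f y).
Proof.
move=> f; apply: (@eqv_retract _ _ _ _ _ (@stack_lower n n n)) => {x y}.
- move=> x y /orP[] /pushP[u [v [-> -> ]]].
    rewrite same_perm => /eqP uv.
    have fE w : f (stack_upper n w) = inl (s (foot s w)).
      by case: w => //= k; rewrite permKV.
    by rewrite !fE uv /same.
  have fE w : f (stack_lower n w) = w by case: w.
  by rewrite !fE.
- by move=> u v uv; apply: eqv_edge; apply/orP; right; apply/pushP; exists u, v.
by case=> [[i|j]|k] //=; exact: eqv_refl.
Qed.

Variables (F : fieldType) (t : F).

(** No power of t appears: every middle vertex is linked to an outer one by the
    permutation.  This is why sandwiching by antisymmetrizers does not depend
    on t. *)
Lemma comp_perm_below :
  comp_diag t (perm_diag s) p = basis F (pull (ext 1%g s^-1%g) p).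
Proof.
rewrite /comp_diag nloops0 ?expr0 ?scale1r.
  congr basis; apply: diag_eq => u v; rewrite same_diag_of stack_perm_below.
  rewrite same_pull; case: u => ?; case: v => ? /=; by rewrite ?perm1.
case=> [[i|j]|k]; [exists (inl i)|exists (inr (s j))|exists (inr k)] => //=;
  exact: eqv_refl.
Qed.

Lemma comp_perm_above :
  comp_diag t p (perm_diag s) = basis F (pull (ext s 1%g) p).
Proof.
rewrite /comp_diag nloops0 ?expr0 ?scale1r.
  congr basis; apply: diag_eq => u v; rewrite same_diag_of stack_perm_above.
  rewrite same_pull; case: u => ?; case: v => ? /=; by rewrite ?perm1.
case=> [[i|j]|k]; first by exists (inl i); apply: eqv_refl.
  exists (inl ((s^-1)%g j)); rewrite eqv_sym /=.
  by have := upper_edge ((s^-1)%g j); rewrite permKV.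
by exists (inr k); apply: eqv_refl.
Qed.

End StackPerm.

Section BasisExpansion.
Variable F : fieldType.

Lemma linear_sumE (V W : lmodType F) (f : V -> W) : linear f ->
  forall (I : finType) (k : I -> F) (v : I -> V),
  f (\sum_i k i *: v i) = \sum_i k i *: f (v i).
Proof.
move=> lin_f I k v; have f0 : f 0 = 0.
  by have := lin_f (-1) 0 0; rewrite !scaleN1r !addNr.
by elim/big_rec2: _ => // i x y _ <-; rewrite lin_f.
Qed.

Lemma basisE a b (f : FP F a b) : f = \sum_p f p *: basis F p.
Proof.
apply/ffunP => q.
have evalD : {morph (fun g : FP F a b => g q : F) : g h / g + h}.
  by move=> g h; rewrite ffunE.
have eval0 : (0 : FP F a b) q = 0 by rewrite ffunE.
rewrite (big_morph (fun g : FP F a b => g q : F) evalD eval0).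
rewrite (bigD1 q) //= big1 => [|p qp]; rewrite !ffunE.
  by rewrite eqxx addr0 [RHS]mulr1.
by rewrite eq_sym (negPf qp) [LHS]mulr0.
Qed.

Lemma sum_basis (V : lmodType F) a b (G : pdiag a b -> V) p :
  \sum_q basis F p q *: G q = G p.
Proof.
rewrite (bigD1 p) //= ffunE eqxx scale1r big1 ?addr0 // => q /negPf qp.
by rewrite ffunE qp scale0r.
Qed.

Lemma comp_basis (t : F) a b c (m : pdiag b c) (p : pdiag a b) :
  Defs.comp t (basis F m) (basis F p) = comp_diag t m p.
Proof.
rewrite /Defs.comp; under eq_bigr => q _ do
  (under eq_bigr => q' _ do rewrite -scalerA; rewrite -scaler_sumr sum_basis).
by rewrite sum_basis.
Qed.

End BasisExpansion.

Lemma extension_linear (F : fieldType) (V : lmodType F) a b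
  (G : pdiag a b -> V) : linear (fun f : FP F a b => \sum_p f p *: G p).
Proof.
move=> k f g; rewrite scaler_sumr -big_split; apply: eq_bigr => p _ /=.
by rewrite !ffunE scalerDl -[k *: f p]/(k * f p) scalerA.
Qed.

Section Extension.
Variables (F : fieldType) (V : lmodType F) (a b : nat) (G : pdiag a b -> V).

Definition extend (f : FP F a b) : V := \sum_p f p *: G p.

HB.instance Definition _ := GRing.isLinear.Build F (FP F a b) V _ extend
  (extension_linear G).

Lemma extend_sum (I : finType) (f : I -> FP F a b) :
  extend (\sum_i f i) = \sum_i extend (f i).
Proof. exact: linear_sum. Qed.

Lemma extendZ k f : extend (k *: f) = k *: extend f.
Proof. exact: (linearZZ extend). Qed.

Lemma extend_basis p : extend (basis F p) = G p.
Proof. exact: sum_basis. Qed.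

End Extension.

Section Sandwich.
Variable F : fieldType.

(** The common shape of s_n and of s_n (x) s_n. *)
Definition perm_sum (A : finType) n (k : A -> F) (g : A -> 'S_n) : FP F n n :=
  \sum_x k x *: basis F (perm_diag (g x)).

Lemma sandwich_basis (t : F) (A : finType) n (k : A -> F) (g : A -> 'S_n) p :
  sandwich t (perm_sum k g) (basis F p) =
  \sum_x \sum_y (k x * k y) *: basis F (pull (ext (g x) (g y)^-1%g) p).
Proof.
rewrite /sandwich /perm_sum (linear_sumE (comp_linear_r t _)) /=.
transitivity (Defs.comp t (perm_sum k g)
    (\sum_x k x *: basis F (pull (ext (g x) 1%g) p))).
  congr (Defs.comp t _ _); apply: eq_bigr => x _; congr (_ *: _).
  exact: etrans (comp_basis _ _ _) (comp_perm_above _ _ _).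
rewrite (linear_sumE (comp_linear_r t _)) /=.
apply: eq_bigr => x _; rewrite (linear_sumE (comp_linear_l t _)) scaler_sumr.
apply: eq_bigr => y _; rewrite scalerA; congr (_ *: _).
apply: etrans (comp_basis _ _ _) _; apply: etrans (comp_perm_below _ _ _) _.
by rewrite pull_ext mulg1 mul1g.
Qed.

End Sandwich.

(** * Two-sided alternation of diagrams and its classification *)

Section Same.
Variables (a b : nat) (p : pdiag a b).

Lemma same_refl u : same p u u.
Proof. exact: eqxx. Qed.

Lemma same_sym u v : same p u v = same p v u.
Proof. exact: eq_sym. Qed.

Lemma same_l u v w : same p u v -> same p u w = same p v w.
Proof. by rewrite /same => /eqP->. Qed.

Lemma same_r u v w : same p u v -> same p w u = same p w v.
Proof. by rewrite /same => /eqP->. Qed.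

Definition isolated (u : 'I_a + 'I_b) : bool :=
  [forall v, same p u v ==> (v == u)].

Lemma isolated_same u v : isolated u -> same p u v = (u == v).
Proof.
move/forallP/(_ v)/implyP => iso; apply/idP/eqP => [/iso/eqP //|->].
exact: same_refl.
Qed.

(** Exchanging two vertices of the same block, or two singletons, leaves the
    partition unchanged.  The map g is left abstract so that top and bottom
    transpositions are both covered. *)
Lemma pull_swap (g : 'I_a + 'I_b -> 'I_a + 'I_b) (w w' : 'I_a + 'I_b) :
    injective g ->
    (forall u, g u = u \/ (u \in [:: w; w']) && (g u \in [:: w; w'])) ->
    same p w w' || (isolated w && isolated w') ->
  pull g p = p.
Proof.
move=> injg gP; have pairP u v : u \in [:: w; w'] -> v \in [:: w; w'] ->
    same p w w' -> same p u v.
  rewrite !inE => /orP[]/eqP-> /orP[]/eqP-> // ww'; rewrite ?same_refl //.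
  by rewrite same_sym.
case/orP => [ww'|/andP[iso iso']]; apply: diag_eq => u v; rewrite same_pull.
  have gu x : same p (g x) x.
    have [->|/andP[xw gxw]] := gP x; first exact: same_refl.
    exact: pairP.
  by rewrite (same_l _ (gu u)) (same_r _ (gu v)).
have isoP x : x \in [:: w; w'] -> isolated x.
  by rewrite !inE => /orP[]/eqP->.
have [gu|/andP[/isoP uw /isoP guw]] := gP u; last first.
  by rewrite (isolated_same _ guw) (isolated_same _ uw) (inj_eq injg).
have [gv|/andP[/isoP vw /isoP gvw]] := gP v; first by rewrite gu gv.
rewrite [LHS]same_sym [RHS]same_sym.
by rewrite (isolated_same _ gvw) (isolated_same _ vw) (inj_eq injg).
Qed.

End Same.

Section Alternate.
Variables (F : fieldType) (n : nat).
Implicit Types (s t : 'S_n) (p : pdiag n n).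

(** Up to the factor n!^2, the product s_n p s_n; see [sandwich_antisym]. *)
Definition alt p : FP F n n :=
  \sum_(s : 'S_n) \sum_(t : 'S_n)
    ((-1) ^+ s * (-1) ^+ t) *: basis F (pull (ext s t) p).

Lemma alt_pull s t p :
  alt (pull (ext s t) p) = ((-1) ^+ s * (-1) ^+ t) *: alt p.
Proof.
rewrite /alt [in RHS](reindex_inj (mulIg s)) scaler_sumr.
apply: eq_bigr => s' _.
rewrite [in RHS](reindex_inj (mulIg t)) scaler_sumr; apply: eq_bigr => t' _.
rewrite pull_ext scalerA !odd_permM !signr_addb; congr (_ *: _).
rewrite -!signr_addb; congr (_ ^+ (nat_of_bool _)).
by do 5!case: (odd _).
Qed.

Hypothesis F2 : 2%:R != 0 :> F.

(** Relabelling by an odd pair both fixes p and changes the sign of the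
    alternating sum. *)
Lemma alt_odd_stable s t p :
  odd_perm s (+) odd_perm t -> pull (ext s t) p = p -> alt p = 0.
Proof.
move=> st pst; have := alt_pull s t p.
rewrite pst -signr_addb st scaleN1r => /eqP; rewrite -subr_eq0 opprK.
by rewrite -mulr2n -scaler_nat scaler_eq0 (negPf F2) => /eqP.
Qed.

Lemma pull_tperm_top a b p :
    same p (inl a) (inl b) || (isolated p (inl a) && isolated p (inl b)) ->
  pull (ext (tperm a b) 1%g) p = p.
Proof.
apply: pull_swap => [|u]; first exact: can_inj (extK _ _).
case: u => j /=; rewrite ?perm1; last by left.
by case: tpermP => [->|->|_ _]; [right|right|left]; rewrite // !inE !eqxx ?orbT.
Qed.

Lemma pull_tperm_bottom a b p :
    same p (inr a) (inr b) || (isolated p (inr a) && isolated p (inr b)) ->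
  pull (ext 1%g (tperm a b)) p = p.
Proof.
apply: pull_swap => [|u]; first exact: can_inj (extK _ _).
case: u => j /=; rewrite ?perm1; first by left.
by case: tpermP => [->|->|_ _]; [right|right|left]; rewrite // !inE !eqxx ?orbT.
Qed.

(** No transposition of top vertices is an obvious symmetry of p.  Together with
    its bottom analogue this leaves only blocks {i}, {j'} and {i,j'}, with at most
    one singleton on each side. *)
Definition rigid_top p :=
  forall a b, a != b ->
  same p (inl a) (inl b) || (isolated p (inl a) && isolated p (inl b)) = false.

Definition rigid_bottom p :=
  forall a b, a != b ->
  same p (inr a) (inr b) || (isolated p (inr a) && isolated p (inr b)) = false.

Lemma alt_eq0_or_rigid p : alt p = 0 \/ rigid_top p /\ rigid_bottom p.
Proof.
have [/existsP[a /existsP[b /andP[ab /pull_tperm_top]]]|top] := boolP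
  [exists a, exists b, (a != b) &&
    (same p (inl a) (inl b) || (isolated p (inl a) && isolated p (inl b)))].
  by move/alt_odd_stable; rewrite odd_tperm odd_perm1 ab; left; auto.
have [/existsP[a /existsP[b /andP[ab /pull_tperm_bottom]]]|bot] := boolP
  [exists a, exists b, (a != b) &&
    (same p (inr a) (inr b) || (isolated p (inr a) && isolated p (inr b)))].
  by move/alt_odd_stable; rewrite odd_tperm odd_perm1 ab; left; auto.
right; split=> a b ab; apply/negP => H.
  case/negP: top; apply/existsP; exists a; apply/existsP; exists b.
  by rewrite ab.
case/negP: bot; apply/existsP; exists a; apply/existsP; exists b.
by rewrite ab.
Qed.

End Alternate.

Section Classification.
Variables (n : nat) (p : pdiag n.+1 n.+1).
Hypotheses (top : rigid_top p) (bot : rigid_bottom p).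
Implicit Types (a b i j : 'I_n.+1).

Lemma rigid_same_top a b : same p (inl a) (inl b) = (a == b).
Proof.
have [->|/top/negbT] := eqVneq a b; first exact: same_refl.
by rewrite negb_or => /andP[/negPf].
Qed.

Lemma rigid_same_bottom a b : same p (inr a) (inr b) = (a == b).
Proof.
have [->|/bot/negbT] := eqVneq a b; first exact: same_refl.
by rewrite negb_or => /andP[/negPf].
Qed.

Lemma unmatched_top a : (forall j, ~~ same p (inl a) (inr j)) ->
  isolated p (inl a).
Proof.
move=> un; apply/forallP => -[b|j]; apply/implyP; last by rewrite (negPf (un j)).
by rewrite rigid_same_top => /eqP->.
Qed.

Lemma unmatched_bottom j : (forall a, ~~ same p (inl a) (inr j)) ->
  isolated p (inr j).
Proof.
move=> un; apply/forallP => -[a|b]; apply/implyP; rewrite same_sym.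
  by rewrite (negPf (un a)).
by rewrite rigid_same_bottom => /eqP->.
Qed.

Lemma matched_all : (forall a, exists j, same p (inl a) (inr j)) ->
  exists s : 'S_n.+1, p = perm_diag s.
Proof.
move=> mat; pose f a := xchoose (mat a).
have fP a : same p (inl a) (inr (f a)) by exact: xchooseP (mat a).
have injf : injective f.
  move=> a b fab; apply/eqP; rewrite -rigid_same_top (same_l _ (fP a)).
  by rewrite same_sym (same_l _ (fP b)) fab same_refl.
exists (perm injf); apply: diag_eq => u v; rewrite same_perm.
have footP w : same p w (inl (foot (perm injf) w)).
  case: w => k /=; first exact: same_refl.
  by rewrite same_sym -{2}[k](permKV (perm injf)) permE.
by rewrite (same_l _ (footP u)) (same_r _ (footP v)) rigid_same_top.
Qed.

(** A top vertex for each bottom vertex is an injection of a finite set into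
    itself, hence onto; so singletons occur on both sides or on neither. *)
Lemma matched_bottom : (forall j, exists a, same p (inl a) (inr j)) ->
  forall a, exists j, same p (inl a) (inr j).
Proof.
move=> mat a; pose g j := xchoose (mat j).
have gP j : same p (inl (g j)) (inr j) by exact: xchooseP (mat j).
have injg : injective g.
  move=> i j gij; apply/eqP; rewrite -rigid_same_bottom -(same_l _ (gP i)).
  by rewrite gij gP.
exists ((perm injg)^-1%g a); rewrite -{1}[a](permKV (perm injg)) permE.
exact: gP.
Qed.

(** The matching of the remaining vertices, completed by sending i0 to j0, is a
    permutation f.  Moving i0 to the last place by s, and j0 along with it by
    t = s o f^-1, identifies p with x_n. *)
Lemma unmatched_pair i0 j0 : isolated p (inl i0) -> isolated p (inr j0) ->
  exists s t : 'S_n.+1, p = pull (ext s t) (x_diag n.+1).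
Proof.
move=> iso iso'.
pose f a := if [pick j | same p (inl a) (inr j)] is Some j then j else j0.
have f0 : f i0 = j0.
  by rewrite /f; case: pickP => // j; rewrite isolated_same.
have fP a : a != i0 -> same p (inl a) (inr (f a)).
  rewrite /f; case: pickP => // un ai0; have := top ai0.
  by rewrite iso unmatched_top ?orbT // => j; rewrite un.
have fN a : a != i0 -> f a != j0.
  move=> ai0; apply/eqP => fa; have := fP _ ai0.
  by rewrite fa same_sym isolated_same.
have injf : injective f.
  move=> a b; have [->|ai] := eqVneq a i0; have [->|bi] := eqVneq b i0 => //.
  - by rewrite f0 => /esym/eqP; rewrite (negPf (fN _ bi)).
  - by rewrite f0 => /eqP; rewrite (negPf (fN _ ai)).
  move=> fab; apply/eqP; rewrite -rigid_same_top (same_l _ (fP _ ai)).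
  by rewrite same_sym (same_l _ (fP _ bi)) fab same_refl.
pose s := tperm i0 ord_max; pose t := ((perm injf)^-1 * s)%g.
(* [L w] represents the block of w: a top vertex where there is one, and j0 on
   its own. *)
exists s, t; pose L (w : 'I_n.+1 + 'I_n.+1) : 'I_n.+1 + 'I_n.+1 :=
  match w with
  | inl a => inl a
  | inr j => if j == j0 then inr j0 else inl ((perm injf)^-1%g j)
  end.
have LP w : same p w (L w).
  case: w => k /=; first exact: same_refl.
  case: eqP => [->|/eqP kj]; first exact: same_refl.
  rewrite same_sym -{2}[k](permKV (perm injf)) permE; apply: fP.
  apply: contra kj => /eqP k0; rewrite -f0 -k0 -[f _](permE injf) permKV.
  exact: eqxx.
have LE u v : same p (L u) (L v) = (L u == L v).
  have LU w : isolated p (L w) \/ exists a, L w = inl a.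
    case: w => k /=; first by right; exists k.
    by case: eqP => [_|_]; [left | right; eexists].
  have [/isolated_same-> //|[a ->]] := LU u.
  have [isoL|[b ->]] := LU v; last exact: rigid_same_top.
  by rewrite same_sym isolated_same // eq_sym.
have xL w : xlabel (ext s t w) = ext s t (L w).
  have lastE j : (j.+1 < n.+1)%N = (j != ord_max).
    by rewrite ltnS ltn_neqAle -ltnS ltn_ord andbT.
  case: w => //= j; rewrite lastE permM; case: (eqVneq j j0) => [->|jj0] /=.
    have -> : (perm injf)^-1%g j0 = i0 by rewrite -f0 -[f _](permE injf) permK.
    by rewrite permM -f0 -[f _](permE injf) permK tpermL eqxx.
  case: eqP => // /(congr1 s); rewrite tpermK tpermR => /(congr1 (perm injf)).
  by rewrite permKV permE f0 => /eqP; rewrite (negPf jj0).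
apply: diag_eq => u v; rewrite same_pull same_x !xL (can_eq (extK _ _)) -LE.
by rewrite (same_l _ (LP u)) (same_r _ (LP v)).
Qed.

Lemma rigid_classification :
  exists s t : 'S_n.+1,
    p = pull (ext s t) (perm_diag 1%g) \/ p = pull (ext s t) (x_diag n.+1).
Proof.
have [/forallP mat|] := boolP [forall a, [exists j, same p (inl a) (inr j)]].
  have [s ->] := matched_all (fun a => existsP (mat a)).
  by exists s, 1%g; left; rewrite perm_diag_pull invg1 mulg1.
rewrite negb_forall => /existsP[i0]; rewrite negb_exists => /forallP un.
have [/forallP mat|] := boolP [forall j, [exists a, same p (inl a) (inr j)]].
  have [j] := matched_bottom (fun j => existsP (mat j)) i0.
  by rewrite (negPf (un j)).
rewrite negb_forall => /existsP[j0]; rewrite negb_exists => /forallP un'.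
have [s [t E]] := unmatched_pair (unmatched_top un) (unmatched_bottom un').
by exists s, t; right.
Qed.

End Classification.

Lemma alt_cases (F : fieldType) (F2 : 2%:R != 0 :> F) n (p : pdiag n.+1 n.+1) :
  exists k : F, alt F p = k *: alt F (perm_diag 1%g)
             \/ alt F p = k *: alt F (x_diag n.+1).
Proof.
have [->|[top bot]] := alt_eq0_or_rigid F2 p.
  by exists 0; left; rewrite scale0r.
have [s [t [->|->]]] := rigid_classification top bot;
  exists ((-1) ^+ s * (-1) ^+ t); [left|right]; exact: alt_pull.
Qed.

(** * Counting colorings with equal top and bottom *)

Section ClosedColorings.
Variables (S : finType) (n : nat).
Implicit Types (C : {ffun 'I_n + 'I_n -> S}) (s t : 'S_n) (p : pdiag n n).

(** The colorings seen by the trace: identifying i with i' closes the diagram. *)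
Definition trace_closed C : bool := [forall k, C (inl k) == C (inr k)].

Definition index_of (x : 'I_n + 'I_n) : 'I_n :=
  match x with inl i | inr i => i end.

Lemma trace_closedP C :
  reflect (forall x, C x = C (inl (index_of x))) (trace_closed C).
Proof.
apply: (iffP forallP) => [H [k|k] //=|H k]; first exact/esym/eqP.
by rewrite (H (inr k)).
Qed.

Lemma coloring_pull (g : 'I_n + 'I_n -> 'I_n + 'I_n) p C :
    (forall x, C (g x) = C x) -> involutive g ->
  coloring (same (pull g p)) C = coloring (same p) C.
Proof.
move=> Cg gK; apply/coloringP/coloringP => H x y.
  by move=> xy; rewrite -Cg -[RHS]Cg; apply: H; rewrite same_pull !gK.
by rewrite same_pull => /H; rewrite !Cg.
Qed.

(** Only for these colorings do the permutations act freely. *)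
Definition rainbow C : bool := injectiveb (fun k => C (inl k)).

(** Compatibility says that s t^-1 moves each vertex to one of the same color; for a
    rainbow coloring this forces s = t. *)
Lemma coloring_id s t C : trace_closed C -> rainbow C ->
  coloring (same (pull (ext s t) (perm_diag 1%g))) C = (s == t).
Proof.
move=> /trace_closedP cl /injectiveP inj; rewrite perm_diag_pull eq_mulgV1.
apply/coloringP/eqP => [H|-> x y].
  apply/permP => a; rewrite perm1; apply: inj.
  have := H (inl a) (inr ((s * t^-1)%g a)).
  rewrite same_perm /= permK eqxx => /(_ isT) Ca.
  exact/esym/(etrans Ca)/cl.
have footE w : foot 1%g w = index_of w by case: w => //= k; rewrite invg1 perm1.
by rewrite same_perm !footE (cl x) (cl y) => /eqP->.
Qed.

End ClosedColorings.

(** Here the coloring compares s and t only away from one vertex, but a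
    permutation is determined by its values on all vertices but one.  So the
    answer is the same as for the identity. *)
Lemma coloring_x (S : finType) n (s t : 'S_n.+1) (C : {ffun _ -> S}) :
    trace_closed C -> rainbow C ->
  coloring (same (pull (ext s t) (x_diag n.+1))) C = (s == t).
Proof.
move=> /trace_closedP cl /injectiveP inj.
have lastE (j : 'I_n.+1) : (j.+1 < n.+1)%N = (j != ord_max).
  by rewrite ltnS ltn_neqAle -ltnS ltn_ord andbT.
apply/coloringP/eqP => [H|-> x y].
  have st a : s a != ord_max -> s a = t a.
    move=> sa; have := H (inl a) (inr ((t^-1)%g (s a))).
    rewrite same_pull same_x /= permKV lastE sa eqxx => /(_ isT).
    by rewrite (cl (inr _)) => /inj /= sta; rewrite [in RHS]sta permKV.
  apply/permP => a; have [sa|/st //] := eqVneq (s a) ord_max.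
  rewrite sa; apply/eqP; rewrite eq_sym; apply: contraT => ta.
  have := st ((s^-1)%g (t a)); rewrite permKV => /(_ ta)/perm_inj a0.
  by move: ta; rewrite -sa {2}a0 permKV eqxx.
have indexE w : index_of (xlabel (ext t t w)) = t (index_of w).
  by case: w => k //=; case: ifP.
rewrite same_pull same_x (cl x) (cl y) => /eqP /(congr1 (@index_of _)).
by rewrite !indexE => /perm_inj->.
Qed.

Section Counting.
Variables (F : fieldType) (d : nat).

Definition ncolorings n (p : pdiag n n) : nat :=
  #|[set C : {ffun 'I_n + 'I_n -> 'I_d.+1} |
      coloring (same p) C && trace_closed C]|.

(** The trace of the operator attached to f on the n-th tensor power of the
    permutation representation on d + 1 colors.  It sees f only through its
    coefficients, so it makes sense whatever the parameter t. *)
Definition chi n (f : FP F n n) : F^o := \sum_p f p * (ncolorings p)%:R.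

Lemma chi_linear n : linear (@chi n).
Proof.
move=> k f g; rewrite /chi scaler_sumr -big_split; apply: eq_bigr => p _ /=.
by rewrite !ffunE mulrDl -[k *: f p]/(k * f p) -mulrA.
Qed.

HB.instance Definition _ n :=
  GRing.isLinear.Build F (FP F n n) F^o _ (@chi n) (@chi_linear n).

Lemma chiD n (f g : FP F n n) : chi (f + g) = chi f + chi g.
Proof. exact: (raddfD (@chi n)). Qed.

Lemma chiZ n k (f : FP F n n) : chi (k *: f) = k * chi f.
Proof. exact: (linearZZ (@chi n)). Qed.

Lemma chi_sum n (I : finType) (f : I -> FP F n n) :
  chi (\sum_i f i) = \sum_i chi (f i).
Proof. exact: linear_sum. Qed.

Lemma chi_basis n (p : pdiag n n) : chi (basis F p) = (ncolorings p)%:R.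
Proof. exact: (sum_basis (fun q => (ncolorings q)%:R : F^o) p). Qed.

Hypothesis F2 : 2%:R != 0 :> F.

(** If two top vertices have the same color, composing s with their transposition
    preserves compatibility and changes the sign. *)
Lemma signed_count0 n (p : pdiag n n) (C : {ffun _ -> 'I_d.+1}) :
    trace_closed C -> ~~ rainbow C ->
  \sum_(s : 'S_n) \sum_(t : 'S_n)
    (-1) ^+ s * (-1) ^+ t * (coloring (same (pull (ext s t) p)) C)%:R = 0 :> F.
Proof.
move=> cl /injectivePn[a [b ab Cab]].
set W := LHS; have : W = - W.
  rewrite {1}/W (reindex_inj (mulgI (tperm a b))) -sumrN.
  apply: eq_bigr => s _; rewrite -sumrN; apply: eq_bigr => t _.
  rewrite odd_permM odd_tperm ab signr_addb expr1 -!mulrA mulN1r; congr (- _).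
  congr (_ * (_ * _)).
  have -> : pull (ext (tperm a b * s)%g t) p
          = pull (ext (tperm a b) 1%g) (pull (ext s t) p).
    by rewrite pull_ext mul1g.
  rewrite coloring_pull // => [[k|k] /=|[k|k] /=].
  - by case: tpermP => [->|->|].
  - by rewrite perm1.
  - by rewrite tpermK.
  - by rewrite !perm1.
move/eqP; rewrite -subr_eq0 opprK -mulr2n -mulr_natl mulf_eq0 (negPf F2).
by move/eqP.
Qed.

Definition nrainbow n : nat :=
  #|[set C : {ffun 'I_n + 'I_n -> 'I_d.+1} | trace_closed C && rainbow C]|.

(** Only rainbow colorings survive the alternation, and in each of them the pairs
    s = t are the only ones that contribute, with sign 1.  The hypothesis holds
    for the identity and for x_n alike: their equal values are the coincidence
    behind the theorem. *)
Lemma chi_alt n (p : pdiag n n) :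
    (forall s t (C : {ffun _ -> 'I_d.+1}), trace_closed C -> rainbow C ->
      coloring (same (pull (ext s t) p)) C = (s == t)) ->
  chi (alt F p) = (n`! * nrainbow n)%:R.
Proof.
move=> pP; have -> : chi (alt F p) =
    \sum_(C : {ffun _ -> 'I_d.+1} | trace_closed C)
    \sum_(s : 'S_n) \sum_(t : 'S_n)
    (-1) ^+ s * (-1) ^+ t * (coloring (same (pull (ext s t) p)) C)%:R.
  rewrite exchange_big chi_sum; apply: eq_bigr => s _.
  rewrite exchange_big chi_sum; apply: eq_bigr => t _.
  rewrite chiZ chi_basis -mulr_sumr; congr (_ * _).
  rewrite /ncolorings -sum1_card natr_sum [RHS]big_mkcond [LHS]big_mkcond.
  by apply: eq_bigr => C _; rewrite inE; case: coloring; case: trace_closed.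
rewrite (bigID (@rainbow _ _)) /= addrC big1 ?add0r; last first.
  by move=> C /andP[cl nr]; apply: signed_count0.
rewrite mulnC natrM /nrainbow -sum1_card natr_sum mulr_suml.
rewrite (eq_bigl _ _ (fun C => in_set _ _)).
apply: eq_bigr => C /andP[cl ra]; rewrite mul1r.
rewrite -card_Sn -sum1_card natr_sum; apply: eq_bigr => s _.
rewrite (bigD1 s) //= pP // eqxx mulr1 -expr2 sqrr_sign big1 ?addr0 // => t ts.
by rewrite pP // eq_sym (negPf ts) mulr0.
Qed.

End Counting.

(** * The antisymmetrizer and its endomorphism algebra *)

Lemma sandwich_EndK (F : fieldType) (t : F) n (e f : FP F n n) :
  sandwich t e f \in EndK t e.
Proof.
by rewrite -[sandwich _ _ _](lfunE (sandwich t e)) memv_img ?memvf.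
Qed.

Section Antisym.
Variables (F : fieldType) (charF0 : [pchar F] =i pred0) (t : F) (n : nat).

Lemma antisym_perm_sum :
  antisym F n = perm_sum (fun s : 'S_n => (n`!%:R)^-1 * (-1) ^+ s) id.
Proof.
by rewrite /antisym scaler_sumr; apply: eq_bigr => s _; rewrite scalerA.
Qed.

Lemma sandwich_antisym p :
  sandwich t (antisym F n) (basis F p) = (n`!%:R ^- 2) *: alt F p.
Proof.
rewrite antisym_perm_sum sandwich_basis scaler_sumr; apply: eq_bigr => s _.
rewrite [LHS](reindex_inj (@invg_inj {perm 'I_n})) scaler_sumr.
apply: eq_bigr => u _ /=.
rewrite scalerA invgK odd_permV; congr (_ *: _).
by rewrite mulrACA -expr2 exprVn.
Qed.

Lemma fact_neq0 : n`!%:R != 0 :> F.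
Proof. by rewrite (pcharf0P F).1 // -lt0n fact_gt0. Qed.

Lemma antisym_alt : antisym F n = (n`!%:R ^- 2) *: alt F (perm_diag 1%g).
Proof.
have -> : alt F (perm_diag 1%g) =
    n`!%:R *: \sum_(s : 'S_n) (-1) ^+ s *: basis F (perm_diag s).
  rewrite /alt exchange_big -card_Sn scaler_nat -sumr_const /=.
  apply: eq_big => [u|u _]; first by rewrite inE.
  rewrite [LHS](reindex_inj (mulIg u)) /=; apply: eq_bigr => s _.
  rewrite perm_diag_pull mulgK odd_permM signr_addb -mulrA -expr2.
  by rewrite sqrr_sign mulr1.
by rewrite scalerA /antisym expr2 invfM mulrVK // unitfE fact_neq0.
Qed.

(** The element [alt p] does not involve t; so End(M_n) is the same subspace of
    FP_n for all t. *)
Lemma alt_EndK p : alt F p \in EndK t (antisym F n).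
Proof.
have -> : alt F p = (n`!%:R ^+ 2) *: sandwich t (antisym F n) (basis F p).
  rewrite sandwich_antisym scalerA mulfV ?scale1r //.
  by rewrite expf_neq0 ?fact_neq0.
by rewrite rpredZ ?sandwich_EndK.
Qed.

End Antisym.

Lemma EndKP (F : fieldType) (t : F) n (e f : FP F n n) : f \in EndK t e ->
  exists g : FP F n n, f = \sum_p g p *: sandwich t e (basis F p).
Proof.
move=> /memv_imgP[g _ ->]; exists g; rewrite lfunE /= {1}[g]basisE linear_sum.
by apply: eq_bigr => p _; rewrite linearZ.
Qed.

(** * Tensor products of permutations *)

Section Block.
Variables (m n : nat).
Implicit Types (s : 'S_m) (t : 'S_n).

Definition block_fun s t (i : 'I_(m + n)) : 'I_(m + n) :=
  match split i with inl j => lshift n (s j) | inr k => rshift m (t k) end.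

Lemma block_funK s t : cancel (block_fun s t) (block_fun s^-1%g t^-1%g).
Proof.
move=> i; rewrite /block_fun; case: (split_ordP i) => [j ->|k ->].
  by rewrite -/(unsplit (inl (s j))) unsplitK permK.
by rewrite -/(unsplit (inr (t k))) unsplitK permK.
Qed.

(** The permutation whose diagram is the juxtaposition of those of s and t. *)
Definition block s t : 'S_(m + n) := perm (can_inj (block_funK s t)).

Lemma block_lshift s t j : block s t (lshift n j) = lshift n (s j).
Proof. by rewrite permE /block_fun (unsplitK (inl j)). Qed.

Lemma block_rshift s t k : block s t (rshift m k) = rshift m (t k).
Proof. by rewrite permE /block_fun (unsplitK (inr k)). Qed.

Lemma blockM s t s' t' : (block s t * block s' t' = block (s * s') (t * t'))%g.
Proof.
apply/permP => i; rewrite permM.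
by case: (split_ordP i) => [j ->|k ->];
   rewrite ?(block_lshift, block_rshift) permM.
Qed.

Lemma juxt_perm s t : juxt (perm_diag s) (perm_diag t) = perm_diag (block s t).
Proof.
apply: diag_eq => u v; rewrite same_diag_of same_perm; set r := (X in eqv X).
have footl x : foot (block s t) (juxt_left n n x) = lshift n (foot s x).
  case: x => //= j; apply: (@perm_inj _ (block s t)).
  by rewrite permKV block_lshift permKV.
have footr x : foot (block s t) (juxt_right m m x) = rshift m (foot t x).
  case: x => //= j; apply: (@perm_inj _ (block s t)).
  by rewrite permKV block_rshift permKV.
apply: eqvE => {u v} [x y|u v].
  case/orP=> /pushP[u [v [-> ->]]]; rewrite same_perm => /eqP uv.
    by rewrite !footl uv.
  by rewrite !footr uv.
have top w : eqv r w (inl (foot (block s t) w)).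
  case: w => k; first exact: eqv_refl.
  rewrite eqv_sym; apply: eqv_edge; rewrite /=.
  set i := fun_of_perm _ k; have -> : k = block s t i by rewrite permKV.
  move: i => i; apply/orP; case: (split_ordP i) => [j ->|j ->].
    left; apply/pushP; exists (inl j), (inr (s j)).
    by rewrite same_perm /= permK block_lshift.
  right; apply/pushP; exists (inl j), (inr (t j)).
  by rewrite same_perm /= permK block_rshift.
by move=> uv; apply: eqv_trans (top u) _; rewrite uv eqv_sym.
Qed.

End Block.

Lemma tens_perm_sum (F : fieldType) (A B : finType) m n (k : A -> F)
    (l : B -> F) (g : A -> 'S_m) (h : B -> 'S_n) :
  tens (perm_sum k g) (perm_sum l h) =
  perm_sum (fun x : A * B => k x.1 * l x.2) (fun x => block (g x.1) (h x.2)).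
Proof.
transitivity (\sum_p perm_sum k g p *:
    (\sum_q perm_sum l h q *: basis F (juxt p q))).
  apply: eq_bigr => p _; rewrite scaler_sumr; apply: eq_bigr => q _.
  by rewrite scalerA.
rewrite [in RHS]/perm_sum -(pair_bigA _ (fun x y =>
  (k x * l y) *: basis F (perm_diag (block (g x) (h y))))) /=.
rewrite {1}/perm_sum (linear_sumE (extension_linear _)).
apply: eq_bigr => x _; rewrite sum_basis.
rewrite {1}/perm_sum (linear_sumE (extension_linear _)) scaler_sumr.
by apply: eq_bigr => y _; rewrite sum_basis juxt_perm scalerA.
Qed.

(** * Partial traces *)

Section Transport.
Variables (T : finType) (r r' : rel T) (g : T -> T) (g' : T -> T).
Hypotheses (gK : cancel g g') (g'K : cancel g' g).
Hypothesis rg : forall x y, r' x y = r (g x) (g y).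

Lemma eqv_transport x y : eqv r' x y = eqv r (g x) (g y).
Proof.
rewrite -[RHS]component_eq.
apply: (@eqvE _ _ _ (component r \o g)) => {x y} x y.
  by rewrite rg => /eqv_edge; rewrite -component_eq => /eqP.
move/eqP; rewrite /= component_eq => xy.
have inv a b : r a b -> (component r' \o g') a = (component r' \o g') b.
  move=> ab; apply/eqP; rewrite /= component_eq; apply: eqv_edge.
  by rewrite rg !g'K.
by have /eqP := eqv_invariant inv xy; rewrite /= !gK component_eq.
Qed.

Lemma nloops_transport (U : finType) (i : U -> T) (h h' : U -> U) :
    cancel h h' -> cancel h' h -> (forall u, g (i u) = i (h u)) ->
  nloops r' i = nloops r i.
Proof.
move=> hK h'K gi; rewrite !nloopsE.
rewrite -(card_imset (loops r' i) (imset_inj (can_inj gK))).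
congr #|pred_of_set _|.
have compE x : g @: component r' x = component r (g x).
  apply/setP => y; rewrite inE; apply/imsetP/idP => [[z]|xy].
    by rewrite inE eqv_transport => xz ->.
  by exists (g' y); rewrite ?inE ?eqv_transport g'K.
have loopE x : [forall u, ~~ eqv r' x (i u)] = [forall u, ~~ eqv r (g x) (i u)].
  apply/forallP/forallP => H u.
    by rewrite -[u]h'K -gi -eqv_transport.
  by rewrite eqv_transport gi.
apply/setP => A; apply/imsetP/imsetP => [[B /imsetP[x xP ->] ->]|[x xP ->]].
  by exists (g x); rewrite ?compE // inE -loopE; move: xP; rewrite inE.
exists (component r' (g' x)); last by rewrite compE g'K.
by rewrite component_loop loopE g'K; move: xP; rewrite inE.
Qed.

End Transport.

(** Left and right partial traces treated at once: J holds the edges that close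
    up one factor, and i embeds the vertices of the factor that remains. *)
Section PartialTrace.
Variables (N n : nat) (J : rel ('I_N + 'I_N)%type).
Variable (i : 'I_n + 'I_n -> 'I_N + 'I_N).
Implicit Types (p : pdiag N N).

Definition glue p : rel ('I_N + 'I_N) :=
  fun x y => push id (val p) x y || J x y.

Definition trace_diag p : pdiag n n := diag_of i (glue p).

Definition trace_loops p : nat := nloops (glue p) i.

(** Colorings of the closed diagram, sorted by their restriction to the remaining
    vertices.  The hypothesis says that closing the factor joined by J and then
    the other one closes everything. *)
Lemma ncolorings_trace d p :
    (forall C : {ffun 'I_N + 'I_N -> 'I_d.+1},
      trace_closed C = coloring J C && trace_closed [ffun u => C (i u)]) ->
  ncolorings d p = (d.+1 ^ trace_loops p * ncolorings d (trace_diag p))%N.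
Proof.
move=> closedJ; pose res (C : {ffun 'I_N + 'I_N -> 'I_d.+1}) :=
  [ffun u => C (i u)].
have glueE C : coloring (glue p) C = coloring (same p) C && coloring J C.
  apply/coloringP/andP => [H|[/coloringP Hp /coloringP HJ] x y].
    split; apply/coloringP => x y xy; apply: H.
      by rewrite /glue push_id xy.
    by rewrite /glue xy orbT.
  by rewrite /glue push_id => /orP[/Hp|/HJ].
rewrite /ncolorings -sum1_card (partition_big res (@trace_closed _ _)) /=;
  last first.
  by move=> C; rewrite inE closedJ => /and3P[].
rewrite -[in RHS]sum1_card big_distrr /= [RHS]big_mkcond [LHS]big_mkcond /=.
apply: eq_bigr => c _; rewrite inE.
case clc: (trace_closed c); last by rewrite andbF.
rewrite andbT muln1; case: ifP => [/coloringP colc|ncol].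
  rewrite -(@card_extensions _ (glue p) _ i d c); last first.
    by move=> u v uv; apply: colc; rewrite same_diag_of.
  rewrite sum1_card; apply: eq_card => C; rewrite !inE glueE.
  rewrite [in LHS]unfold_in /= inE closedJ.
  have -> : (res C == c) = [forall u, C (i u) == c u].
    apply/eqP/forallP => [<- u|H]; first by rewrite ffunE.
    by apply/ffunP => u; rewrite ffunE; apply/eqP.
  case E : [forall u, _]; rewrite ?andbF // !andbT.
  suff -> : [ffun u => C (i u)] = c by rewrite clc andbT.
  by apply/ffunP => u; rewrite ffunE; apply/eqP/(forallP E).
rewrite big1 // => C; rewrite inE closedJ => /andP[/and3P[pC JC _] /eqP cE].
case/negP: ncol; apply/coloringP => u v; rewrite same_diag_of -cE !ffunE.
by apply: eqv_invariant; apply/coloringP; rewrite glueE pC.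
Qed.

Variables (F : fieldType) (t0 : F).

Definition trace_FP p : FP F n n :=
  t0 ^+ trace_loops p *: basis F (trace_diag p).

(** For fixed h the trace of a partial trace is a polynomial in the parameter. *)
Lemma chi_trace_poly d (h : FP F N N) :
  chi d (\sum_p h p *: trace_FP p) =
  (\sum_p (h p * (ncolorings d (trace_diag p))%:R) *: 'X^(trace_loops p)).[t0].
Proof.
rewrite chi_sum horner_sum; apply: eq_bigr => p _.
by rewrite !chiZ chi_basis hornerZ hornerXn -mulrA [_ * t0 ^+ _]mulrC.
Qed.

(** At t = d + 1 the factors t match the free choices of colors. *)
Lemma chi_trace d (h : FP F N N) :
    t0 = d.+1%:R ->
    (forall C : {ffun 'I_N + 'I_N -> 'I_d.+1},
      trace_closed C = coloring J C && trace_closed [ffun u => C (i u)]) ->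
  chi d (\sum_p h p *: trace_FP p) = chi d h.
Proof.
move=> t0E closedJ; rewrite chi_sum; apply: eq_bigr => p _.
by rewrite !chiZ chi_basis ncolorings_trace // natrM natrX t0E.
Qed.

Variable (delta : 'S_n -> 'S_N).
Hypothesis delta_i :
  forall s t u, ext (delta s) (delta t) (i u) = i (ext s t u).
Hypothesis delta_J :
  forall s t x y, J (ext (delta s) (delta t) x) (ext (delta s) (delta t) y)
                = J x y.

Let glue_pull s t p x y :
  glue (pull (ext (delta s) (delta t)) p) x y
    = glue p (ext (delta s) (delta t) x) (ext (delta s) (delta t) y).
Proof. by rewrite /glue !push_id same_pull delta_J. Qed.

Lemma trace_diag_pull s t p :
  trace_diag (pull (ext (delta s) (delta t)) p)
    = pull (ext s t) (trace_diag p).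
Proof.
apply: diag_eq => u v; rewrite same_pull !same_diag_of.
by rewrite (eqv_transport (extK _ _) (extVK _ _) (glue_pull s t p)) !delta_i.
Qed.

Lemma trace_loops_pull s t p :
  trace_loops (pull (ext (delta s) (delta t)) p) = trace_loops p.
Proof.
exact: (nloops_transport (extK _ _) (extVK _ _) (glue_pull s t p)
  (extK s t) (extVK s t) (delta_i s t)).
Qed.

(** Relabelling the remaining factor commutes with the partial trace, so that
    alternating before or after it gives the same result. *)
Lemma trace_alt p :
  \sum_(s : 'S_n) \sum_(t : 'S_n) ((-1) ^+ s * (-1) ^+ t) *:
      trace_FP (pull (ext (delta s) (delta t)) p)
    = t0 ^+ trace_loops p *: alt F (trace_diag p).
Proof.
rewrite scaler_sumr; apply: eq_bigr => s _.
rewrite scaler_sumr; apply: eq_bigr => t _.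
rewrite /trace_FP trace_diag_pull trace_loops_pull !scalerA.
by congr (_ *: _); rewrite mulrC.
Qed.

End PartialTrace.

(** * Traces of endomorphisms of the tensor square *)

Section TensorSquare.
Variables (F : fieldType) (t : F) (n : nat).

Lemma block_inv m (s : 'S_m) (u : 'S_n) :
  ((block s u)^-1 = block s^-1 u^-1)%g.
Proof.
apply/eqP; rewrite eq_invg_mul blockM !mulgV.
apply/eqP/permP => i; rewrite perm1.
by case: (split_ordP i) => [j ->|k ->];
   rewrite ?(block_lshift, block_rshift) perm1.
Qed.

(** The indices are regrouped by tensor factor: x holds the top and bottom
    permutations of the left factor, y those of the right one.  The bottom ones
    are inverted, because composing with a permutation below relabels the bottom
    vertices by its inverse. *)
Lemma sandwich_tens p :
  sandwich t (tens (antisym F n) (antisym F n)) (basis F p) =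
  n`!%:R ^- 4 *: \sum_(x : 'S_n * 'S_n) \sum_(y : 'S_n * 'S_n)
    ((-1) ^+ x.1 * (-1) ^+ x.2) *: (((-1) ^+ y.1 * (-1) ^+ y.2) *:
      basis F (pull (ext (block x.1 y.1) (block x.2 y.2)) p)).
Proof.
rewrite antisym_perm_sum tens_perm_sum sandwich_basis.
rewrite !pair_bigA scaler_sumr /=.
pose f (z : ('S_n * 'S_n) * ('S_n * 'S_n)) :=
  ((z.1.1, z.2.1), (z.1.2^-1, z.2.2^-1))%g.
pose g (z : ('S_n * 'S_n) * ('S_n * 'S_n)) :=
  ((z.1.1, z.2.1^-1), (z.1.2, z.2.2^-1))%g.
have fK : cancel f g by move=> [[a b] [c d]]; rewrite /f /g /= !invgK.
have gK : cancel g f by move=> [[a b] [c d]]; rewrite /f /g /= !invgK.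
(* [f] transposes the two-by-two array of permutations. *)
rewrite [LHS](reindex f) /=; last by exists g => z _; rewrite ?fK ?gK.
apply: eq_bigr => -[[s1 t1] [s2 t2]] _ /=.
rewrite !scalerA block_inv !invgK !odd_permV; congr (_ *: _).
rewrite -exprVn; move: (_^-1) => c.
rewrite (mulrACA c _ c) (mulrACA c _ c) (mulrACA (c * c)) (exprD c 2 2) expr2.
by congr (_ * _); rewrite mulrACA.
Qed.

End TensorSquare.

Section TensorSquareTraces.
Variables (F : fieldType) (charF0 : [pchar F] =i pred0) (t : F) (n : nat).

Lemma juxt_left_block m (s u : 'S_m) (v : 'I_m + 'I_m) :
  ext (block s (1%g : 'S_n)) (block u 1%g) (juxt_left n n v)
    = juxt_left n n (ext s u v).
Proof. by case: v => k /=; rewrite block_lshift. Qed.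

Lemma juxt_right_block m (s u : 'S_n) (v : 'I_n + 'I_n) :
  ext (block (1%g : 'S_m) s) (block 1%g u) (juxt_right m m v)
    = juxt_right m m (ext s u v).
Proof. by case: v => k /=; rewrite block_rshift. Qed.

Definition join_left m : rel ('I_(m + n) + 'I_(m + n)) := fun x y =>
  [exists i : 'I_m, (x == inl (lshift n i)) && (y == inr (lshift n i))].

Definition join_right m : rel ('I_(m + n) + 'I_(m + n)) := fun x y =>
  [exists i : 'I_n, (x == inl (rshift m i)) && (y == inr (rshift m i))].

Lemma join_left_block m (s u : 'S_n) x y :
  join_left (ext (block (1%g : 'S_m) s) (block 1%g u) x)
    (ext (block (1%g : 'S_m) s) (block 1%g u) y) = join_left x y.
Proof.
apply: eq_existsb => i.
have bl r : block (1%g : 'S_m) r (lshift n i) = lshift n i.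
  by rewrite block_lshift perm1.
rewrite -(inj_eq (can_inj (extK (block 1 s)%g (block 1 u)%g)) x).
rewrite -(inj_eq (can_inj (extK (block 1 s)%g (block 1 u)%g)) y).
by rewrite /= !bl.
Qed.

Lemma join_right_block m (s u : 'S_m) x y :
  join_right (ext (block s (1%g : 'S_n)) (block u 1%g) x)
    (ext (block s (1%g : 'S_n)) (block u 1%g) y) = join_right x y.
Proof.
apply: eq_existsb => i.
have bl r : block r (1%g : 'S_n) (rshift m i) = rshift m i.
  by rewrite block_rshift perm1.
rewrite -(inj_eq (can_inj (extK (block s 1)%g (block u 1)%g)) x).
rewrite -(inj_eq (can_inj (extK (block s 1)%g (block u 1)%g)) y).
by rewrite /= !bl.
Qed.

Lemma trace_closed_left (S : finType) m
    (C : {ffun 'I_(m + n) + 'I_(m + n) -> S}) :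
  trace_closed C =
  coloring (@join_left m) C && trace_closed [ffun u => C (juxt_right m m u)].
Proof.
apply/forallP/andP => [H|[/coloringP HJ /forallP Hi] k].
  split; last by apply/forallP => k; rewrite !ffunE /= H.
  by apply/coloringP => x y /existsP[i /andP[/eqP-> /eqP->]]; apply/eqP.
case: (split_ordP k) => [j ->|j ->]; last by move: (Hi j); rewrite !ffunE.
by apply/eqP/HJ/existsP; exists j; rewrite !eqxx.
Qed.

Lemma trace_closed_right (S : finType) m
    (C : {ffun 'I_(m + n) + 'I_(m + n) -> S}) :
  trace_closed C =
  coloring (@join_right m) C && trace_closed [ffun u => C (juxt_left n n u)].
Proof.
apply/forallP/andP => [H|[/coloringP HJ /forallP Hi] k].
  split; last by apply/forallP => k; rewrite !ffunE /= H.
  by apply/coloringP => x y /existsP[i /andP[/eqP-> /eqP->]]; apply/eqP.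
case: (split_ordP k) => [j ->|j ->]; first by move: (Hi j); rewrite !ffunE.
by apply/eqP/HJ/existsP; exists j; rewrite !eqxx.
Qed.

(** G will be a partial trace at a parameter unrelated to t. *)
Lemma trace_tens_mem (V : {vspace FP F n n})
    (G : pdiag (n + n) (n + n) -> FP F n n) h :
    h \in EndK t (tens (antisym F n) (antisym F n)) ->
    (forall p, \sum_(x : 'S_n * 'S_n) \sum_(y : 'S_n * 'S_n)
      ((-1) ^+ x.1 * (-1) ^+ x.2) *: (((-1) ^+ y.1 * (-1) ^+ y.2) *:
        G (pull (ext (block x.1 y.1) (block x.2 y.2)) p)) \in V) ->
  \sum_p h p *: G p \in V.
Proof.
case/EndKP => g ->; rewrite -/(extend G _) extend_sum => GV.
apply: memv_suml => p _; rewrite sandwich_tens !extendZ !rpredZ //.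
rewrite extend_sum; move: (GV p); congr (_ \in V); apply: eq_bigr => x _.
rewrite extend_sum; apply: eq_bigr => y _.
by rewrite !extendZ extend_basis.
Qed.

(** The parameter t' of the trace varies independently of the algebra, as the
    comparison with integral values requires. *)
Lemma trL_EndK t' h : h \in EndK t (tens (antisym F n) (antisym F n)) ->
  trL t' h \in EndK t (antisym F n).
Proof.
move=> hE.
apply: (@trace_tens_mem _ (trace_FP (@join_left n) (@juxt_right n n n n) t') h)
  => // p.
apply: memv_suml => x _; rewrite -scaler_sumr rpredZ //.
have blockE (y : 'S_n * 'S_n) : pull (ext (block x.1 y.1) (block x.2 y.2)) p =
    pull (ext (block 1%g y.1) (block 1%g y.2))
      (pull (ext (block x.1 1%g) (block x.2 1%g)) p).
  by rewrite pull_ext !blockM !mulg1 !mul1g.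
under eq_bigr => y _ do rewrite blockE.
rewrite -(pair_bigA _ (fun y1 y2 : 'S_n => ((-1) ^+ y1 * (-1) ^+ y2) *:
  trace_FP (@join_left n) (@juxt_right n n n n) t'
   (pull (ext (block 1%g y1) (block 1%g y2)) _))) /=.
rewrite (@trace_alt _ _ _ _ _ _ (block 1%g)) ?rpredZ ?alt_EndK //.
  exact: juxt_right_block.
exact: join_left_block.
Qed.

Lemma trR_EndK t' h : h \in EndK t (tens (antisym F n) (antisym F n)) ->
  trR t' h \in EndK t (antisym F n).
Proof.
move=> hE.
apply: (@trace_tens_mem _ (trace_FP (@join_right n) (@juxt_left n n n n) t') h)
  => // p.
rewrite exchange_big /=; apply: memv_suml => y _.
under eq_bigr => x _ do rewrite scalerA mulrC -scalerA.
rewrite -scaler_sumr rpredZ //.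
have blockE (x : 'S_n * 'S_n) : pull (ext (block x.1 y.1) (block x.2 y.2)) p =
    pull (ext (block x.1 1%g) (block x.2 1%g))
      (pull (ext (block 1%g y.1) (block 1%g y.2)) p).
  by rewrite pull_ext !blockM !mulg1 !mul1g.
under eq_bigr => x _ do rewrite blockE.
rewrite -(pair_bigA _ (fun x1 x2 : 'S_n => ((-1) ^+ x1 * (-1) ^+ x2) *:
  trace_FP (@join_right n) (@juxt_left n n n n) t'
   (pull (ext (block x1 1%g) (block x2 1%g)) _))) /=.
rewrite (@trace_alt _ _ _ _ _ _ (fun s => block s 1%g)) ?rpredZ ?alt_EndK //.
  exact: juxt_left_block.
exact: join_right_block.
Qed.

End TensorSquareTraces.

(** * The ambidextrous trace *)

Section CharZero.
Variables (F : fieldType) (charF0 : [pchar F] =i pred0).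

Lemma two_neq0 : 2%:R != 0 :> F.
Proof. by rewrite (pcharf0P F).1. Qed.

Lemma natr_inj : injective (fun k : nat => k%:R : F).
Proof.
move=> j k; wlog jk : j k / (j <= k)%N => [W|/esym/eqP].
  by case/orP: (leq_total j k) => [/W//|/W E /esym/E].
rewrite -subr_eq0 -natrB // (pcharf0P F).1 // => /eqP kj.
by apply/eqP; rewrite eqn_leq jk /= -subn_eq0 kj.
Qed.

(** In characteristic zero the integers give infinitely many distinct roots. *)
Lemma poly_eq0_nat (q : {poly F}) (n : nat) :
  (forall d, (n <= d)%N -> q.[d.+1%:R] = 0) -> q = 0.
Proof.
move=> qr; apply/eqP; apply: contraT => q0.
pose rs := [seq (n + k).+1%:R : F | k <- iota 0 (size q)].
have /(max_poly_roots q0) : all (root q) rs.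
  by apply/allP => _ /mapP[k _ ->]; rewrite rootE qr ?leq_addr.
rewrite size_map size_iota ltnn => /(_ _)/negP[]//.
rewrite map_inj_uniq ?iota_uniq // => j k /natr_inj/eqP.
by rewrite eqSS eqn_add2l => /eqP.
Qed.

Variables (t : F) (n : nat).
Local Notation E := (EndK t (antisym F n.+1)).
Local Notation sx := (sandwich t (antisym F n.+1) (basis F (x_diag n.+1))).
Local Notation N d := ((n.+1)`! * nrainbow d n.+1)%:R.

Lemma chi_antisym d : chi d (antisym F n.+1) = (n.+1)`!%:R ^- 2 * N d.
Proof.
rewrite antisym_alt // chiZ (chi_alt two_neq0) // => s u C; exact: coloring_id.
Qed.

Lemma chi_sx d : chi d sx = (n.+1)`!%:R ^- 2 * N d.
Proof.
rewrite sandwich_antisym chiZ (chi_alt two_neq0) // => s u C; exact: coloring_x.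
Qed.

(** With at least n + 1 colors the top vertices can be given distinct ones. *)
Lemma nrainbow_neq0 d : (n <= d)%N -> N d != 0 :> F.
Proof.
move=> nd; rewrite (pcharf0P F).1 // muln_eq0 negb_or -!lt0n fact_gt0 /=.
apply/card_gt0P; exists [ffun x => inord (index_of x)]; rewrite inE.
apply/andP; split; first by apply/forallP => k; rewrite !ffunE.
apply/injectiveP => i j; rewrite !ffunE /= => /(congr1 val) /=.
have lt_d (k : 'I_n.+1) : (k < d.+1)%N by apply: leq_trans (ltn_ord k) _.
by rewrite !inordK // => /val_inj.
Qed.

Lemma sandwich_cases p : exists k : F,
  sandwich t (antisym F n.+1) (basis F p) = k *: antisym F n.+1 \/
  sandwich t (antisym F n.+1) (basis F p) = k *: sx.
Proof.
have [k altp] := alt_cases two_neq0 p; exists k.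
have swap (c : F) (v : FP F n.+1 n.+1) : c *: (k *: v) = k *: (c *: v).
  by rewrite !scalerA mulrC.
case: altp => altp; [left | right];
  apply: etrans (sandwich_antisym t p) _;
  apply: etrans (congr1 ( *:%R _) altp) _;
  apply: etrans (swap _ _) _; congr (_ *: _); apply/esym.
  exact: antisym_alt.
exact: sandwich_antisym.
Qed.

Lemma EndK_span f : f \in E ->
  exists a b : F, f = a *: antisym F n.+1 + b *: sx.
Proof.
case/EndKP => g ->; elim/big_rec: _ => [|p _ _ [a [b ->]]].
  by exists 0, 0; rewrite !scale0r addr0.
have [k sandp] := sandwich_cases p.
case: sandp => sandp.
  exists (g p * k + a), b; rewrite addrA scalerDl -scalerA.
  by congr (_ *: _ + _ + _).
exists a, (g p * k + b); rewrite addrCA scalerDl -scalerA.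
by congr (_ + (_ *: _ + _)).
Qed.

(** All the traces [chi d] are proportional on End(M_n), since each takes equal
    values on the two spanning elements.  The factors are multiples of the
    dimensions of exterior powers; only their nonvanishing matters. *)
Lemma chi_EndK d e f : f \in E -> chi d f * N e = chi e f * N d.
Proof.
case/EndK_span => a [b ->]; rewrite !chiD !(chiZ _ a) !(chiZ _ b).
rewrite !chi_antisym !chi_sx.
by rewrite -!mulrDl -!mulrA; congr (_ * (_ * _)); rewrite mulrC.
Qed.

Lemma antisym_EndK : antisym F n.+1 \in E.
Proof.
have altE := memvZ ((n.+1)`!%:R ^- 2) (alt_EndK charF0 t (perm_diag 1%g)).
have := congr1 (fun f => f \in E) (antisym_alt charF0 n.+1).
by rewrite /= altE.
Qed.

Lemma sx_EndK : sx \in E.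
Proof. exact: sandwich_EndK. Qed.

(** Equal as polynomials in the parameter, because equal when the parameter is a
    large number of colors. *)
Lemma chi_trL_trR h : h \in EndK t (tens (antisym F n.+1) (antisym F n.+1)) ->
  chi n (trL t h) = chi n (trR t h).
Proof.
move=> hE.
have L t' := @chi_trace_poly _ _ (@join_left n.+1 n.+1)
  (@juxt_right n.+1 n.+1 n.+1 n.+1) F t' n h.
have R t' := @chi_trace_poly _ _ (@join_right n.+1 n.+1)
  (@juxt_left n.+1 n.+1 n.+1 n.+1) F t' n h.
(* [pL] and [pR] are the values as polynomials in the parameter, for fixed h. *)
set pL := (\sum_p _) in L; set pR := (\sum_p _) in R.
rewrite [LHS]L [RHS]R; congr _.[t].
apply/eqP; rewrite -subr_eq0; apply/eqP/(@poly_eq0_nat _ n) => d nd.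
rewrite hornerD hornerN -L -R.
apply/eqP; rewrite subr_eq0; apply/eqP/(mulIf (nrainbow_neq0 nd)).
apply: etrans (chi_EndK n d (trL_EndK charF0 d.+1%:R hE)) _.
apply: etrans _ (esym (chi_EndK n d (trR_EndK charF0 d.+1%:R hE))).
apply: (congr1 (fun z : F => z * N n)).
transitivity (chi d h).
  apply: (@chi_trace _ _ (@join_left n.+1 n.+1)) => // C.
  exact: trace_closed_left.
apply/esym; apply: (@chi_trace _ _ (@join_right n.+1 n.+1)) => // C.
exact: trace_closed_right.
Qed.

(** [chi n] uses n + 1 colors, the least number for which it is nonzero on
    M_(n+1); the scalar makes its value at s_(n+1) equal to 1. *)
Definition colored_trace : 'Hom(subvs_of E, F^o) :=
  ((n.+1)`!%:R ^+ 2 / N n) *: linfun (@chi F n n.+1 \o vsval).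

Lemma colored_traceE f : f \in E ->
  colored_trace (vsproj E f) = (n.+1)`!%:R ^+ 2 / N n * chi n f.
Proof. by move=> fE; rewrite scale_lfunE lfunE /= vsprojK. Qed.

Lemma is_tn_colored_trace : is_tn colored_trace.
Proof.
have cN : (n.+1)`!%:R ^+ 2 / N n * ((n.+1)`!%:R ^- 2 * N n) = 1 :> F.
  rewrite mulrACA mulfV ?expf_neq0 ?fact_neq0 // mulVf ?mulr1 //.
  exact: nrainbow_neq0.
by split; rewrite colored_traceE ?antisym_EndK ?sx_EndK ?chi_antisym ?chi_sx.
Qed.

Lemma is_tn_unique (T T' : 'Hom(subvs_of E, F^o)) :
  is_tn T -> is_tn T' -> T = T'.
Proof.
move=> tnT tnT'; apply/lfunP => v; rewrite -[v]vsvalK.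
have [a [b ->]] := EndK_span (subvsP v).
suff TE (U : 'Hom(subvs_of E, F^o)) : is_tn U ->
    U (vsproj E (a *: antisym F n.+1 + b *: sx)) = a + b by rewrite !TE.
have UD f g : U (vsproj E (f + g)) = U (vsproj E f) + U (vsproj E g).
  by rewrite !linearD.
have UZ c f : U (vsproj E (c *: f)) = c * U (vsproj E f).
  by rewrite !linearZ.
by case=> Us Ux; rewrite UD (UZ a) (UZ b) Us Ux !mulr1.
Qed.

End CharZero.

Unset Implicit Arguments.

Theorem theorem5p9 (F : fieldType) (charF0 : [pchar F] =i pred0) (t : F)
    (n : nat) (n_gt0 : (0 < n)%N) :
  (exists! T : 'Hom(subvs_of (EndK t (antisym F n)), F^o), is_tn T)
  /\ (forall T : 'Hom(subvs_of (EndK t (antisym F n)), F^o),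
        is_tn T -> T <> 0 /\ ambidextrous T).
Proof.
case: n n_gt0 => [//|n _].
have tnP := is_tn_colored_trace charF0 t n; split.
  by exists (colored_trace t n); split=> // T; apply: is_tn_unique.
move=> T tnT; split=> [T0|h hE].
  by case: tnT; rewrite T0 zero_lfunE => /esym/eqP; rewrite oner_eq0.
rewrite (is_tn_unique charF0 tnT tnP).
apply: etrans (colored_traceE (trL_EndK charF0 t hE)) _.
apply: etrans _ (esym (colored_traceE (trR_EndK charF0 t hE))).
apply: (congr1 (fun z : F =>
  (n.+1)`!%:R ^+ 2 / ((n.+1)`! * nrainbow n n.+1)%:R * z)).
exact: chi_trL_trR.
Qed.
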